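(* Let $\mathbb K$ be a field, let $d\geq 1$ be an integer, and let $V$ be a vector space over $\mathbb K$ of dimension $d+1$. Let $\{E^{*}_{i}\}_{i=0}^{d}$ be a system of mutually orthogonal idempotents in $\mathrm{End}(V)$. Let $A\in\mathrm{End}(V)$ be such that for $0\leq i,j\leq d$, $E^{*}_{i}AE^{*}_{j}=0$ if $|i-j|>1$ and $E^{*}_{i}AE^{*}_{j}\neq 0$ if $|i-j|=1$. Let $\{\theta^{*}_{i}\}_{i=0}^{d}$ be scalars in $\mathbb K$ and define $A^{*}=\sum_{i=0}^{d}\theta^{*}_{i}E^{*}_{i}$. Let $\{\theta_{i}\}_{i=0}^{d}$ be any scalars in $\mathbb K$. Suppose the following (i)--(vi) hold. (i) $\theta_{i}\neq\theta_{j}$ if $i\neq j$ $(0\leq i,j\leq d)$. (ii) $\theta^{*}_{i}\neq\theta^{*}_{0}$ $(1\leq i\leq d)$. (iii) There exist $\beta,\gamma^{*}\in\mathbb K$ such that $\gamma^{*}=\theta^{*}_{i-1}-\beta\theta^{*}_{i}+\theta^{*}_{i+1}$ for $1\leq i\leq d-1$. Define $\theta^{*}_{-1}$ (resp. $\theta^{*}_{d+1}$) such that this equation also holds at $i=0$ (resp. $i=d$). (iv) There exist nonzero vectors $v_{0},v_{1}\in V$ such that $Av_{0}=\theta_{0}v_{0}$, $Av_{1}=\theta_{1}v_{1}$, and $A^{*}v_{0}-v_{1}\in\mathbb K v_{0}$. (v) There exist $\gamma,\omega,\eta^{*}\in\mathbb K$ such that for $0\leq i\leq d$, $$a_{i}(\theta^{*}_{i}-\theta^{*}_{i-1})(\theta^{*}_{i}-\theta^{*}_{i+1})=\gamma(\theta^{*}_{i})^{2}+\omega\theta^{*}_{i}+\eta^{*},$$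 where $a_{i}=\mathrm{tr}(E^{*}_{i}A)$. (vi) $\theta_{i-1}-\beta\theta_{i}+\theta_{i+1}=\gamma$ for $1\leq i\leq d-1$, where $\beta$ is the scalar from (iii) and $\gamma$ is the scalar from (v). Then $A,A^{*}$ is a Leonard pair on $V$ with eigenvalue sequence $\{\theta_{i}\}_{i=0}^{d}$ and dual eigenvalue sequence $\{\theta^{*}_{i}\}_{i=0}^{d}$.
   Context: $\mathrm{End}(V)$ is the $\mathbb K$-algebra of $\mathbb K$-linear maps $V\to V$, and $\mathrm{tr}$ is the trace. The symbol $A^{*}$ is just a name for a linear map (not an adjoint or conjugate-transpose). With $\dim V=d+1$, a system of mutually orthogonal idempotents in $\mathrm{End}(V)$ is a sequence $\{E_{i}\}_{i=0}^{d}$ in $\mathrm{End}(V)$ with $E_{i}E_{j}=\delta_{i,j}E_{i}$ $(0\le i,j\le d)$ and $\mathrm{rank}(E_{i})=1$ $(0\le i\le d)$. A square matrix is tridiagonal if each nonzero entry lies on the diagonal, subdiagonal, or superdiagonal; a tridiagonal matrix is irreducible if every subdiagonal entry and every superdiagonal entry is nonzero. A Leonard pair on $V$ is an ordered pair of $\mathbb K$-linear maps $A,A^{*}:V\to V$ such that (1) there is a basis of $V$ with respect to which $A$ is represented by an irreducible tridiagonal matrix and $A^{*}$ by a diagonal matrix; (2) there is a basis of $V$ with respect to which $A^{*}$ is represented by an irreducible tridiagonal matrix and $A$ by a diagonal matrix. An element of $\mathrm{End}(V)$ is multiplicity-free if it is diagonalizable (over $\mathbb K$) and each of its eigenspaces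 has dimension one. For a multiplicity-free $A$, the primitive idempotent of $A$ for an eigenvalue $\theta$ is the projection onto the $\theta$-eigenspace that vanishes on all other eigenspaces. A Leonard system on $V$ is a sequence $\Phi=(A;\{E_{i}\}_{i=0}^{d};A^{*};\{E^{*}_{i}\}_{i=0}^{d})$ such that: each of $A,A^{*}$ is a multiplicity-free element of $\mathrm{End}(V)$; $\{E_{i}\}_{i=0}^{d}$ is an ordering of the primitive idempotents of $A$; $\{E^{*}_{i}\}_{i=0}^{d}$ is an ordering of the primitive idempotents of $A^{*}$; for $0\le i,j\le d$, each of $E^{*}_{i}AE^{*}_{j}$ and $E_{i}A^{*}E_{j}$ is zero if $|i-j|>1$ and nonzero if $|i-j|=1$. The eigenvalue sequence (resp. dual eigenvalue sequence) of $\Phi$ is $\{\theta_{i}\}_{i=0}^{d}$ (resp. $\{\theta^{*}_{i}\}_{i=0}^{d}$), where $\theta_{i}$ (resp. $\theta^{*}_{i}$) is the eigenvalue of $A$ (resp. $A^{*}$) on $E_{i}V$ (resp. $E^{*}_{i}V$). The pair $A,A^{*}$ is then a Leonard pair, said to be associated with $\Phi$. A Leonard pair $A,A^{*}$ has eigenvalue sequence $\{\theta_{i}\}_{i=0}^{d}$ and dual eigenvalue sequence $\{\theta^{*}_{i}\}_{i=0}^{d}$ when these are the eigenvalue sequence and dual eigenvalue sequence of an associated Leonard system. *)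

(* Defs.v *)
From mathcomp Require Import all_boot all_order all_algebra.
Set Implicit Arguments.
Unset Strict Implicit.
Unset Printing Implicit Defensive.
Import Order.TTheory GRing.Theory Num.Theory passmx.
Local Open Scope ring_scope.

Section Matrices.
Variables (K : fieldType) (n : nat).

Definition tridiagonal (B : 'M[K]_n) : Prop :=
  forall i j : 'I_n, B i j != 0 -> `|i%:Z - j%:Z| <= 1.

Definition irreducible_tridiagonal (B : 'M[K]_n) : Prop :=
  tridiagonal B /\ forall i j : 'I_n, `|i%:Z - j%:Z| = 1 -> B i j != 0.

End Matrices.

(* [mxof e e f] acts on row vectors, so it is the transpose of the matrix with
   [f e_j = \sum_i B i j *: e_i]; being diagonal, being irreducible tridiagonal
   and the trace are all invariant under transposition. *)
Section Endomorphisms.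
Variables (K : fieldType) (V : vectType K).

(* The trace does not depend on the basis; [vbasis] is one that is at hand. *)
Definition lftrace (f : 'End(V)) : K :=
  \tr (mxof (vbasis {:V}) (vbasis {:V}) f).

Definition lfdiagonalizable (A : 'End(V)) : Prop :=
  exists2 e : (\dim {:V}).-tuple V,
    basis_of {:V} e & is_diag_mx (mxof e e A).

Definition multiplicity_free (A : 'End(V)) : Prop :=
  lfdiagonalizable A /\
  forall a : K, leigenvalue A a -> \dim (leigenspace A a) = 1%N.

Definition primitive_idempotent (A : 'End(V)) (a : K) (E : 'End(V)) : Prop :=
  [/\ leigenvalue A a,
      (E \o E)%VF = E,
      limg E = leigenspace A a
    & forall b : K, b != a -> (leigenspace A b <= lker E)%VS].

Definition leonard_pair (A As : 'End(V)) : Prop :=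
  (exists e : (\dim {:V}).-tuple V,
     [/\ basis_of {:V} e,
         irreducible_tridiagonal (mxof e e A)
       & is_diag_mx (mxof e e As)]) /\
  (exists e : (\dim {:V}).-tuple V,
     [/\ basis_of {:V} e,
         irreducible_tridiagonal (mxof e e As)
       & is_diag_mx (mxof e e A)]).

End Endomorphisms.

Section LeonardSystems.
Variables (K : fieldType) (V : vectType K) (d : nat).
Implicit Types (A As : 'End(V)) (E Es : 'I_d.+1 -> 'End(V)).
Implicit Types (th ths : 'I_d.+1 -> K).

Definition orthogonal_idempotents E : Prop :=
  (forall i j, (E i \o E j)%VF = if i == j then E i else 0) /\
  (forall i, \dim (limg (E i)) = 1%N).

Definition irreducible_tridiagonal_action E A : Prop :=
  forall i j : 'I_d.+1,
    (`|i%:Z - j%:Z| > 1 -> (E i \o A \o E j)%VF = 0) /\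
    (`|i%:Z - j%:Z| = 1 -> (E i \o A \o E j)%VF <> 0).

Definition primitive_idempotent_ordering A E : Prop :=
  injective E /\
  forall F : 'End(V),
    (exists a, primitive_idempotent A a F) <-> (exists i, F = E i).

Definition leonard_system A E As Es : Prop :=
  [/\ multiplicity_free A /\ multiplicity_free As,
      primitive_idempotent_ordering A E,
      primitive_idempotent_ordering As Es,
      irreducible_tridiagonal_action Es A
    & irreducible_tridiagonal_action E As].

Definition eigenvalue_sequence A E th : Prop :=
  forall i, (limg (E i) <= leigenspace A (th i))%VS.

Definition leonard_pair_with_eigenvalues A As th ths : Prop :=
  leonard_pair A As /\
  exists E Es,
    [/\ leonard_system A E As Es,
        eigenvalue_sequence A E th
      & eigenvalue_sequence As Es ths].

End LeonardSystems.

Section ThreeTermRecurrence.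
Variables (K : fieldType) (d : nat).
Implicit Types (th : 'I_d.+1 -> K) (beta gamma : K) (i : 'I_d.+1).

Definition three_term beta gamma th : Prop :=
  forall i, (0 < i < d)%N ->
    th (inord i.-1) - beta * th i + th (inord i.+1) = gamma.

(* [th_(i-1)] and [th_(i+1)] for [0 <= i <= d], the out-of-range values
   [th_(-1)] and [th_(d+1)] being those that make
   [th_(i-1) - beta * th_i + th_(i+1) = gamma] hold at [i = 0] and [i = d].
   Meant for [1 <= d]. *)
Definition prev_term beta gamma th i : K :=
  if i == 0%N :> nat then gamma + beta * th i - th (inord 1)
  else th (inord i.-1).

Definition next_term beta gamma th i : K :=
  if i == d :> nat then gamma + beta * th i - th (inord d.-1)
  else th (inord i.+1).

End ThreeTermRecurrence.

(* Main.v *)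
(* In a basis adapted to the [Es i], [A] is an irreducible tridiagonal matrix [M]
   and [As] a diagonal matrix [D].  Conditions (iii) and (v) say exactly that [M]
   and [D] satisfy the second Askey-Wilson relation, which is linear in [M].
   Applied to an eigenvector [v_(k-1)], it shows with (vi) that
   [As v_k = v_(k+1) + (combination of v_0, ..., v_k)] with
   [A v_(k+1) = th_(k+1) v_(k+1)]; the vector [v_(k+1)] is nonzero since otherwise
   the span of [v_0, ..., v_k] would be stable under [A] and [As], whereas by (ii)
   [V] has no proper nonzero subspace of this kind.  So [As] is Hessenberg in the
   eigenbasis [v_0, ..., v_d] of [A].  Both maps are self-adjoint for a
   nondegenerate symmetric form that is diagonal in the original basis, and the
   [v_i] are orthogonal for it, so the Hessenberg matrix is irreducible
   tridiagonal.  A diagonalizable map with such a matrix has simple eigenvalues,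
   hence the [ths i] are distinct. *)
Require Import Defs.
From mathcomp Require Import all_boot all_order all_algebra.
From HB Require Import structures.
From mathcomp Require Import zify ring.
Set Implicit Arguments.
Unset Strict Implicit.
Unset Printing Implicit Defensive.
Import Order.TTheory GRing.Theory Num.Theory passmx.
Local Open Scope ring_scope.

(** * Subspaces stable under a tridiagonal and a diagonal matrix *)

(** Comparing indices in [nat] removes the integer absolute values; this is the form suited to
    entrywise arguments. *)
Lemma irreducible_tridiagonalP (K : fieldType) n (B : 'M[K]_n) :
  irreducible_tridiagonal B <->
  (forall i j : 'I_n, (i.+1 < j)%N || (j.+1 < i)%N -> B i j = 0) /\
  (forall i j : 'I_n, i.+1 = j -> B i j != 0 /\ B j i != 0).
Proof.
split=> -[B0 B1]; split=> i j.
- by move=> ij; apply/eqP/negP => /negP/B0; lia.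
- by move=> ij; split; apply: B1; lia.
- by move=> /eqP Bij; case: (boolP ((i.+1 < j)%N || (j.+1 < i)%N)) => [/B0//|]; lia.
- move=> ij; have [/B1[]//|/B1[]//] : i.+1 = j \/ j.+1 = i by lia.
Qed.

Section Stable.
Variables (K : fieldType) (n : nat) (B : 'M[K]_n.+1).
Hypothesis B_trid : irreducible_tridiagonal B.

Lemma tridiagonal_row_succ (x : 'rV[K]_n.+1) (k l : 'I_n.+1) : l = k.+1 :> nat ->
  (forall i : 'I_n.+1, (i <= k)%N -> x 0 i = 0) -> (x *m B) 0 k = x 0 l * B l k.
Proof.
move=> lk x0; have [B0 _] := (irreducible_tridiagonalP B).1 B_trid.
rewrite mxE (bigD1 l) //= big1 ?addr0 // => i il.
have [ik|ki] := leqP i k; first by rewrite x0 ?mul0r.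
by rewrite B0 ?mulr0 //; move: il; rewrite -val_eqE /=; lia.
Qed.

(** If the coordinates up to [k] vanish on all of [W], they vanish on [x *m B], whose coordinate [k]
    is coordinate [k.+1] of [x] times a nonzero subdiagonal entry. *)
Lemma stable_col0_eq0 m (W : 'M[K]_(m, n.+1)) :
  stablemx W B -> (forall x : 'rV_n.+1, (x <= W)%MS -> x 0 0 = 0) -> W = 0.
Proof.
move=> WB W0; have [_ B1] := (irreducible_tridiagonalP B).1 B_trid.
suff H k : forall x : 'rV_n.+1, (x <= W)%MS ->
    forall i : 'I_n.+1, (i <= k)%N -> x 0 i = 0.
  apply/row_matrixP => i; apply/rowP => j.
  by rewrite (H n (row i W) (row_sub _ _)) ?row0 ?mxE // leq_ord.
elim: k => [|k IHk] x xW i.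
  rewrite leqn0 => /eqP i0.
  by rewrite (_ : i = 0) ?W0 //; apply: val_inj.
rewrite leq_eqVlt => /orP[/eqP ik|]; last exact: IHk.
have k_lt : (k < n.+1)%N by have := ltn_ord i; lia.
have := IHk (x *m B) (submx_trans (submxMr _ xW) WB) (Ordinal k_lt) (leqnn _).
rewrite (@tridiagonal_row_succ x (Ordinal k_lt) i) //; last exact: IHk.
have [_ /negPf Bik] := B1 (Ordinal k_lt) i (esym ik).
by move/eqP; rewrite mulf_eq0 Bik orbF => /eqP.
Qed.

(** Row [k] of [B] is the image of the [k]-th unit vector; its nonzero superdiagonal entry brings
    the next unit vector into [W]. *)
Lemma stable_delta0_full m (W : 'M[K]_(m, n.+1)) :
  stablemx W B -> (('e_0 : 'rV_n.+1) <= W)%MS -> row_full W.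
Proof.
move=> WB W0; have [B0 B1] := (irreducible_tridiagonalP B).1 B_trid.
suff H k : forall i : 'I_n.+1, (i <= k)%N -> (('e_i : 'rV_n.+1) <= W)%MS.
  by rewrite -sub1mx; apply/row_subP => i; rewrite row1 (H n) // leq_ord.
elim: k => [|k IHk] i.
  by rewrite leqn0 => /eqP i0; rewrite (_ : i = 0) //; apply: val_inj.
rewrite leq_eqVlt => /orP[/eqP ik|]; last exact: IHk.
have k_lt : (k < n.+1)%N by have := ltn_ord i; lia.
have [Bki _] := B1 (Ordinal k_lt) i (esym ik).
have := submx_trans (submxMr B (IHk (Ordinal k_lt) (leqnn _))) WB.
rewrite -rowE => BkW.
pose rest := \sum_(j | j != i) row (Ordinal k_lt) B 0 j *: ('e_j : 'rV_n.+1).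
have restW : (rest <= W)%MS.
  apply: summx_sub => j ji; rewrite mxE.
  have [jk|kj] := leqP j k; first by rewrite scalemx_sub ?IHk.
  by rewrite B0 ?scale0r ?sub0mx //=; move: ji; rewrite -val_eqE /=; lia.
rewrite -['e_i]scale1r -(mulVf Bki) -scalerA scalemx_sub //.
have -> : B (Ordinal k_lt) i *: 'e_i = row (Ordinal k_lt) B - rest.
  by rewrite {1}[row _ B]row_sum_delta (bigD1 i) //= addrK !mxE.
by rewrite addmx_sub ?eqmx_opp.
Qed.

End Stable.

Section StableDiag.
Variables (K : fieldType) (n : nat) (s : 'I_n.+1 -> K) (i : 'I_n.+1).
Hypothesis s_neq : forall j, j != i -> s j != s i.

(* [s i] being a simple eigenvalue of the diagonal matrix, the projection onto
   the [i]-th coordinate is a polynomial in it. *)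
Lemma stablemx_diag_proj m (W : 'M[K]_(m.+1, n.+1)) (x : 'rV_n.+1) :
  stablemx W (diag_mx (\row_j s j)) -> (x <= W)%MS ->
  ((x 0 i *: 'e_i : 'rV_n.+1) <= W)%MS.
Proof.
move=> WD xW; pose p := \prod_(j | j != i) ('X - (s j)%:P).
have pj j : j != i -> p.[s j] = 0.
  by move=> ji; rewrite horner_prod (bigD1 j) //= !hornerE subrr mul0r.
have pi_neq0 : p.[s i] != 0.
  rewrite horner_prod; apply/prodf_neq0 => j ji.
  by rewrite !hornerE subr_eq0 eq_sym s_neq.
have := submx_trans (submxMr (horner_mx _ p) xW) (horner_mx_stable p WD).
rewrite horner_mx_diag mul_mx_diag.
rewrite (_ : \matrix_(_, _) _ = p.[s i] *: (x 0 i *: 'e_i)).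
  by move: (x 0 i *: _) => y; rewrite (eqmx_scale _ pi_neq0).
apply/rowP => j; rewrite !mxE eqxx /=.
have [->|ji] := eqVneq j i; first by rewrite !mulr1 mulrC.
by rewrite (pj j ji) !mulr0.
Qed.

End StableDiag.

(** Some vector of [W] has a nonzero coordinate 0, otherwise [W] would vanish. Projecting it onto
    that coordinate puts the first unit vector into [W], and [M] then generates everything. *)
Lemma stablemx_full (K : fieldType) m n (M : 'M[K]_n.+1) (s : 'I_n.+1 -> K)
    (W : 'M[K]_(m.+1, n.+1)) :
  irreducible_tridiagonal M -> (forall i, i != 0 -> s i != s 0) ->
  stablemx W M -> stablemx W (diag_mx (\row_i s i)) -> W != 0 -> row_full W.
Proof.
move=> M_trid s_neq0 WM WD W_neq0.
apply: (stable_delta0_full M_trid WM); apply/negPn/negP => W_e0.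
case/negP: W_neq0; apply/eqP/(stable_col0_eq0 M_trid WM) => x xW.
have := stablemx_diag_proj s_neq0 WD xW.
by move=> x0W; apply/eqP/negPn/negP => x0; case/negP: W_e0; rewrite eqmx_scale in x0W.
Qed.

(** The linear relations among the rows of [P] form a space stable under the diagonal matrix of [t].
    Projecting a relation onto each coordinate leaves one-term relations between nonzero rows. *)
Lemma eigenvectors_unitmx (K : fieldType) n (M P : 'M[K]_n.+1) (t : 'I_n.+1 -> K) :
  injective t -> P *m M = diag_mx (\row_i t i) *m P ->
  (forall i, row i P != 0) -> P \in unitmx.
Proof.
move=> t_inj PM P_neq0; rewrite -row_free_unit -kermx_eq0 -submx0.
have kerD : stablemx (kermx P) (diag_mx (\row_i t i)).
  by rewrite sub_kermx -mulmxA -PM mulmxA mulmx_ker mul0mx.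
apply/rV_subP => x xP; rewrite submx0; apply/eqP/rowP => i; rewrite mxE.
have t_neq j : j != i -> t j != t i by rewrite (inj_eq t_inj).
have := stablemx_diag_proj t_neq kerD xP.
rewrite sub_kermx -scalemxAl -rowE scaler_eq0 (negPf (P_neq0 i)) orbF.
by move/eqP.
Qed.

(** * Spans of initial segments of a sequence of vectors *)

Section Chain.
Variables (K : fieldType) (n : nat) (v : nat -> 'rV[K]_n).

(** The span of the first [k] vectors is handled as a row space; indexing [v] by [nat] keeps one
    sequence for all lengths. *)
Definition prefix_mx k : 'M[K]_(k, n) := \matrix_(i < k) v i.

Lemma prefix_mx_sub k i : (i < k)%N -> (v i <= prefix_mx k)%MS.
Proof. by move=> ik; rewrite -[v i](rowK (fun j : 'I_k => v j) (Ordinal ik)) row_sub. Qed.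

Lemma prefix_mx_subP k m (W : 'M_(m, n)) :
  (forall i, (i < k)%N -> (v i <= W)%MS) -> (prefix_mx k <= W)%MS.
Proof. by move=> vW; apply/row_subP => i; rewrite rowK vW. Qed.

Lemma prefix_mxS k l : (k <= l)%N -> (prefix_mx k <= prefix_mx l)%MS.
Proof. by move=> kl; apply: prefix_mx_subP => i ik; rewrite prefix_mx_sub ?(leq_trans ik). Qed.

Lemma prefix_mx_mul_sub k m (W : 'M_(m, n)) (F : 'M_n) (x : 'rV_n) :
  (forall i, (i < k)%N -> (v i *m F <= W)%MS) ->
  (x <= prefix_mx k)%MS -> (x *m F <= W)%MS.
Proof.
move=> vF xS; apply: submx_trans (submxMr F xS) _.
by apply/row_subP => i; rewrite row_mul rowK vF.
Qed.

Lemma prefix_mx_sum k (x : 'rV_n) : (x <= prefix_mx k)%MS ->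
  exists c : 'I_k -> K, x = \sum_(i < k) c i *: v i.
Proof.
case/submxP => c ->; exists (c 0); rewrite mulmx_sum_row.
by apply: eq_bigr => i _; rewrite rowK.
Qed.

End Chain.

(** * The second Askey-Wilson relation and the chain of eigenvectors *)

Section AskeyWilson.
Variables (K : fieldType) (d : nat) (M : 'M[K]_d.+1) (s : 'I_d.+1 -> K).
Variables (beta gammas gamma omega etas : K).
Hypothesis d_ge1 : (1 <= d)%N.
Hypothesis M_trid : irreducible_tridiagonal M.
Hypothesis s_rec : three_term beta gammas s.
Hypothesis M_diag : forall i,
  M i i * (s i - prev_term beta gammas s i) * (s i - next_term beta gammas s i)
  = gamma * s i ^+ 2 + omega * s i + etas.
Let D := diag_mx (\row_i s i).

(** The left side of the Askey-Wilson relation has [(i, j)] entry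
    [M i j * (q (s i) (s j) - rho)]. *)
Let q (x y : K) := x ^+ 2 - beta * x * y + y ^+ 2 - gammas * (x + y).
Let rho := q (s ord0) (s (inord 1)).

(** For consecutive terms [x], [y], [z], the difference [q y z - q x y] factors as
    [(z - x) * (x - beta * y + z - gammas)], which is zero by the recurrence. *)
Lemma three_term_invariant (i j : 'I_d.+1) : i.+1 = j -> q (s i) (s j) = rho.
Proof.
case: i => i; elim: i j => [|i IHi] j i_lt /= ij.
  by congr (q (s _) (s _)); apply: val_inj; rewrite /= -?ij ?inordK.
have i_lt' : (i < d.+1)%N by exact: ltnW.
have /= := @s_rec (Ordinal i_lt); rewrite -ltnS ij ltn_ord => /(_ isT).
rewrite -(IHi (Ordinal i_lt) i_lt' erefl).
rewrite (_ : inord i = Ordinal i_lt'); last by apply: val_inj; rewrite /= inordK.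
rewrite inord_val.
by rewrite /q => <-; ring.
Qed.

(** The two neighbours of [s i] sum to [gammas + beta * s i], also at the ends by the choice of the
    out-of-range terms. The value [rho] is read off on the next term, or on the previous one at the
    last index. *)
Lemma prev_next_term (i : 'I_d.+1) :
  (s i - prev_term beta gammas s i) * (s i - next_term beta gammas s i)
  = q (s i) (s i) - rho.
Proof.
have prevE : prev_term beta gammas s i = gammas + beta * s i - next_term beta gammas s i.
  rewrite /prev_term /next_term; case: eqP => [i0|/eqP i_neq0].
    by rewrite i0 ltn_eqF.
  case: eqP => [id|/eqP i_neqd]; first by rewrite id; ring.
  rewrite -(@s_rec i); first by ring.
  by rewrite lt0n i_neq0 ltn_neqAle i_neqd -ltnS /=.
have [id|i_neqd] := eqVneq (i : nat) d.
  rewrite -(@three_term_invariant (inord i.-1) i); last first.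
    by rewrite inordK id ?prednK // ltnW.
  by rewrite prevE /next_term id eqxx /q; ring.
rewrite -(@three_term_invariant i (inord i.+1)); last first.
  by rewrite inordK // ltnS ltn_neqAle i_neqd -ltnS /=.
by rewrite prevE /next_term (negPf i_neqd) /q; ring.
Qed.

(** Entrywise: [M i j] vanishes away from the three diagonals, [q (s i) (s j) = rho] for adjacent
    indices, and the diagonal entries are [M_diag]. *)
Lemma askey_wilson :
  M *m D *m D - beta *: (D *m M *m D) + D *m D *m M
    - gammas *: (M *m D + D *m M) - rho *: M
  = gamma *: (D *m D) + omega *: D + etas%:M.
Proof.
have [M0 M1] := (irreducible_tridiagonalP M).1 M_trid.
apply/matrixP => i j; rewrite /D -!(mulmxA (diag_mx _)) !(mul_diag_mx, mul_mx_diag) !mxE.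
transitivity (M i j * (q (s i) (s j) - rho)); first by rewrite /q; ring.
have [<-|ij] := eqVneq i j.
  by rewrite -prev_next_term mulrA M_diag !mulr1n; ring.
rewrite !mulr0n !mulr0 !addr0.
have [ij'|ji|ij'] := ltngtP i.+1 j; first by rewrite M0 ?ij' ?mul0r.
  have [jj|ji'|ji'] := ltngtP j.+1 i.
  - by rewrite M0 ?jj ?orbT ?mul0r.
  - by case/eqP: ij; apply: val_inj => /=; lia.
  - rewrite -(three_term_invariant ji'); rewrite /q; ring.
by rewrite three_term_invariant // subrr mulr0.
Qed.

End AskeyWilson.

Section EigenvectorChain.
Variables (K : fieldType) (d : nat) (M : 'M[K]_d.+1) (s : 'I_d.+1 -> K).
Variables (t : nat -> K) (beta gammas rho gamma omega etas : K).
Hypothesis M_trid : irreducible_tridiagonal M.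
Hypothesis s_neq0 : forall i : 'I_d.+1, i != 0 -> s i != s 0.
Let D := diag_mx (\row_i s i).
Hypothesis aw : M *m D *m D - beta *: (D *m M *m D) + D *m D *m M
    - gammas *: (M *m D + D *m M) - rho *: M
  = gamma *: (D *m D) + omega *: D + etas%:M.
Hypothesis t_inj : forall i j, (i <= d)%N -> (j <= d)%N -> t i = t j -> i = j.
Hypothesis t_rec : forall k, (0 < k < d)%N -> t k.+1 = gamma + beta * t k - t k.-1.

(** Requiring [v i *m D] to be [v i.+1] modulo the span of [v 0], ..., [v i] makes [D] Hessenberg
    with off-diagonal coefficients normalized to 1. Terms past [k] are left free. *)
Definition eigenchain (v : nat -> 'rV[K]_d.+1) k :=
  (forall i, (i <= k)%N -> v i *m M = t i *: v i /\ v i != 0) /\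
  (forall i, (i < k)%N -> (v i *m D - v i.+1 <= prefix_mx v i.+1)%MS).

Lemma eigenchain_mulD v k i : eigenchain v k -> (i < k)%N ->
  (v i *m D <= prefix_mx v i.+2)%MS.
Proof.
move=> [_ vD] ik; rewrite -[v i *m D](subrK (v i.+1)) addmx_sub //.
  exact: submx_trans (vD i ik) (prefix_mxS _ _).
exact: prefix_mx_sub.
Qed.

Lemma eigenchain_stableM v k l : eigenchain v k -> (l <= k.+1)%N ->
  stablemx (prefix_mx v l) M.
Proof.
move=> [vM _] lk; apply/row_subP => i; rewrite row_mul rowK.
have [-> _] := vM i (leq_trans (ltn_ord i) lk).
by rewrite scalemx_sub ?prefix_mx_sub.
Qed.

Lemma eigenchain_mulD_prefix v k l (x : 'rV_d.+1) : eigenchain v k -> (l <= k)%N ->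
  (x <= prefix_mx v l)%MS -> (x *m D <= prefix_mx v l.+1)%MS.
Proof.
move=> vk lk; apply: prefix_mx_mul_sub => i il.
apply: submx_trans (eigenchain_mulD vk (leq_trans il lk)) _.
exact: prefix_mxS.
Qed.

(* The Askey-Wilson relation applied to [v k.-1] *)
Lemma eigenchain_shift v k : eigenchain v k -> (0 < k < d)%N ->
  (v k *m D *m M - t k.+1 *: (v k *m D) <= prefix_mx v k.+1)%MS.
Proof.
move=> vk; case: k vk => // k vk /= kd.
have [vM vD] := vk.
pose x := v k; pose w := v k.+1 *m D.
have xM : x *m M = t k *: x by case: (vM k (leqnSn k)).
have vM1 : v k.+1 *m M = t k.+1 *: v k.+1 by case: (vM k.+1 (leqnn _)).
have [y xD yS] : exists2 y, x *m D = v k.+1 + y & (y <= prefix_mx v k.+1)%MS.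
  by exists (x *m D - v k.+1); [rewrite addrC subrK | exact: vD].
have yDS : (y *m D <= prefix_mx v k.+2)%MS by exact: eigenchain_mulD_prefix vk _ yS.
have yMS : (y *m M <= prefix_mx v k.+1)%MS.
  by apply: submx_trans (submxMr _ yS) (eigenchain_stableM vk _); rewrite ltnW.
have yMDS : (y *m M *m D <= prefix_mx v k.+2)%MS.
  exact: eigenchain_mulD_prefix vk _ yMS.
have yDMS : (y *m D *m M <= prefix_mx v k.+2)%MS.
  exact: submx_trans (submxMr _ yDS) (eigenchain_stableM vk _).
have xS : (x <= prefix_mx v k.+2)%MS by exact: prefix_mx_sub.
have vS : (v k.+1 <= prefix_mx v k.+2)%MS by exact: prefix_mx_sub.
have yS' : (y <= prefix_mx v k.+2)%MS by exact: submx_trans yS (prefix_mxS _ _).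
have yMS' : (y *m M <= prefix_mx v k.+2)%MS by exact: submx_trans yMS (prefix_mxS _ _).
(* The relation applied to [x] and solved for [w *m M]: the terms in [w] combine by [t_rec] into
   [t k.+2 *: w], and all others lie in the span of [v 0], ..., [v k.+1]. *)
have -> : w *m M - t k.+2 *: w =
  (gamma - t k) *: (y *m D) + omega *: (v k.+1 + y) + etas *: x
  + beta *: (y *m M *m D) - y *m D *m M
  + gammas *: (t k *: (v k.+1 + y) + t k.+1 *: v k.+1 + y *m M) + (rho * t k) *: x.
  have := congr1 (mulmx x) aw.
  rewrite !(mulmxDr, mulmxBr, mulmxN, =^~ scalemxAr, mulmxA, mul_mx_scalar).
  rewrite xM -!scalemxAl xD !mulmxDl vM1 -!scalemxAl -/w (@t_rec k.+1 kd) /=.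
  move=> xaw; apply/rowP => j; move/(congr1 (fun u : 'rV_d.+1 => u 0 j)): xaw.
  move: (y *m D *m M) (y *m M *m D) (y *m D) (y *m M) (w *m M) (w) => y1 y2 y3 y4 y5 y6.
  rewrite !mxE => /eqP; rewrite -subr_eq0 => /eqP xaw.
  by apply/eqP; rewrite -subr_eq0; apply/eqP; rewrite -[RHS]xaw; ring.
by rewrite !(addmx_sub, scalemx_sub, eqmx_opp).
Qed.

(** [v k *m D] is an eigenvector for [t k.+1] up to an error in the span of [v 0], ..., [v k]. Since
    [t k.+1] is not an eigenvalue there, a correction inside that span removes the error. *)
Lemma eigenchain_extend v k : eigenchain v k -> (0 < k < d)%N ->
  exists v', eigenchain v' k.+1.
Proof.
move=> vk kd; have [vM vD] := vk.
have [c cE] := prefix_mx_sum (eigenchain_shift vk kd).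
(* On the [i]-th eigenvector, [M] minus the scalar [t k.+1] acts as [t i - t k.+1], hence the
   denominators. *)
pose z := \sum_(i < k.+1) (c i / (t i - t k.+1)) *: v i.
pose y := v k *m D - z.
have zS : (z <= prefix_mx v k.+1)%MS.
  by apply: summx_sub => i _; rewrite scalemx_sub ?prefix_mx_sub.
have yM : y *m M = t k.+1 *: y.
  have zM : z *m M - t k.+1 *: z = v k *m D *m M - t k.+1 *: (v k *m D).
    rewrite cE mulmx_suml scaler_sumr -sumrB; apply: eq_bigr => i _.
    have /vM[vMi _] : (i <= k)%N by rewrite -ltnS ltn_ord.
    rewrite -scalemxAl vMi !scalerA -scalerBl [t k.+1 * _]mulrC -mulrBr divfK // subr_eq0.
    apply/negP => /eqP/t_inj; have := ltn_ord i; lia.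
  apply/eqP; rewrite -subr_eq0 mulmxBl scalerBr opprD addrACA -opprD zM.
  by rewrite subrr.
have y_neq0 : y != 0.
  apply/negP => /eqP y0.
  have vkD : v k *m D = z by apply/eqP; rewrite -subr_eq0 -y0.
  (* If [y] were zero, the span would be stable under both matrices and hence full, but it has only
     [k.+1 <= d] generators. *)
  have /eqP : row_full (prefix_mx v k.+1).
    apply: (stablemx_full M_trid s_neq0).
    - exact: eigenchain_stableM vk _.
    - apply/row_subP => i; rewrite row_mul rowK -/D.
      have [->|ik] := eqVneq (i : nat) k; first by rewrite vkD.
      have ik' : (i < k)%N by rewrite ltn_neqAle ik -ltnS ltn_ord.
      exact: submx_trans (eigenchain_mulD vk ik') (prefix_mxS _ _).
    - apply/negP => /eqP S0; have [_ /negP[]] := vM 0%N isT.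
      by have := prefix_mx_sub v (ltn0Sn k); rewrite S0 => /submx0null->.
  have := rank_leq_row (prefix_mx v k.+1); case/andP: kd; lia.
exists (fun i => if (i <= k)%N then v i else y).
have prefixE i : (i <= k.+1)%N ->
    prefix_mx (fun i => if (i <= k)%N then v i else y) i = prefix_mx v i.
  by move=> ik; apply/row_matrixP => j; rewrite !rowK -ltnS (leq_trans (ltn_ord j) ik).
split=> i ik.
  have [/vM//|ki] := leqP i k.
  by rewrite (_ : i = k.+1) //; apply/eqP; rewrite eqn_leq ik ki.
rewrite prefixE //; case: ltnP => ik'.
  by rewrite (ltnW ik') vD.
have -> : i = k by apply/eqP; rewrite eqn_leq ik' -ltnS ik.
by rewrite leqnn /y opprB addrC subrK.
Qed.

Lemma eigenchain_exists (v0 v1 : 'rV_d.+1) c : (0 < d)%N -> v0 != 0 -> v1 != 0 ->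
  v0 *m M = t 0 *: v0 -> v1 *m M = t 1 *: v1 -> v0 *m D - v1 = c *: v0 ->
  exists v, eigenchain v d.
Proof.
move=> d_gt0 v0_neq0 v1_neq0 v0M v1M v0D.
suff H k : (k < d)%N -> exists v, eigenchain v k.+1.
  by have := H d.-1; rewrite prednK //; apply.
elim: k => [|k IHk] kd; last first.
  by have [v vk] := IHk (ltnW kd); apply: eigenchain_extend vk _.
exists (fun i => if i == 0%N then v0 else v1); split=> -[|[|i]] //= _.
by rewrite v0D scalemx_sub // (prefix_mx_sub (fun i => if i == 0%N then v0 else v1) (ltnSn 0)).
Qed.

End EigenvectorChain.

(** * Tridiagonality in the eigenbasis *)

(** The weights are partial products of the ratios of subdiagonal to superdiagonal entries. They
    define the diagonal form for which [M] is self-adjoint. *)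
Lemma tridiagonal_symmetrizer (K : fieldType) n (M : 'M[K]_n.+1) :
  irreducible_tridiagonal M ->
  exists2 k : 'I_n.+1 -> K, (forall i, k i != 0) &
    (forall i j, M i j * k j = M j i * k i).
Proof.
case/irreducible_tridiagonalP => M0 M1.
pose r i := M (inord i.+1) (inord i) / M (inord i) (inord i.+1).
exists (fun j : 'I_n.+1 => \prod_(0 <= i < j) r i) => [j|].
  rewrite prodf_seq_neq0; apply/allP => i; rewrite mem_index_iota => ij /=.
  have i_lt : (i.+1 < n.+1)%N by rewrite (leq_ltn_trans _ (ltn_ord j)); case/andP: ij.
  have [|Mij Mji] := M1 (inord i) (inord i.+1); first by rewrite !inordK // ltnW.
  by rewrite mulf_neq0 ?invr_neq0.
have sym_succ (i j : 'I_n.+1) : i.+1 = j ->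
    M i j * \prod_(0 <= l < j) r l = M j i * \prod_(0 <= l < i) r l.
  move=> ij; have [Mij _] := M1 i j ij.
  by rewrite -ij big_nat_recr //= /r ij !inord_val mulrCA [M i j * _]mulrC divfK // mulrC.
move=> i j; have [->//|ij] := eqVneq i j.
case: (ltngtP i.+1 j) => [ij'|ji|/sym_succ//]; first by rewrite !M0 ?ij' ?orbT // !mul0r.
case: (ltngtP j.+1 i) => [ji'|ji'|/sym_succ//]; first by rewrite !M0 ?ji' ?orbT // !mul0r.
by case/eqP: ij; apply: val_inj => /=; lia.
Qed.

(** Coordinates with respect to the independent vectors [v i] are unique, and those of a vector of
    the smaller span stop before [l]. *)
Lemma prefix_mx_coef (K : fieldType) n (v : nat -> 'rV[K]_n) l (x : 'rV_n) :
  prefix_mx v n \in unitmx -> (l <= n)%N ->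
  (x *m prefix_mx v n <= prefix_mx v l)%MS ->
  forall j : 'I_n, (l <= j)%N -> x 0 j = 0.
Proof.
move=> vU ln /submxP[a xa] j lj.
have vl : prefix_mx v l = (\matrix_(i < l, j < n) (i == j :> nat)%:R) *m prefix_mx v n.
  apply/row_matrixP => i; rewrite row_mul !rowK mulmx_sum_row.
  rewrite (bigD1 (widen_ord ln i)) //= !mxE eqxx scale1r big1 ?addr0 ?rowK // => k ki.
  by rewrite !mxE -[i : nat]/(widen_ord ln i : nat) val_eqE eq_sym (negPf ki) scale0r.
move: xa; rewrite vl mulmxA => /(can_inj (mulmxK vU)) ->.
rewrite mxE big1 // => i _; rewrite mxE ltn_eqF ?mulr0 //.
exact: leq_trans (ltn_ord i) lj.
Qed.

Lemma tridiagonal_eigenvector_eq0 (K : fieldType) n (B : 'M[K]_n.+1) a (x : 'rV_n.+1) :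
  irreducible_tridiagonal B -> x *m B = a *: x -> x 0 0 = 0 -> x = 0.
Proof.
move=> B_trid xB x0; apply: (stable_col0_eq0 B_trid); first by rewrite xB scalemx_sub.
by move=> y /sub_rVP[b ->]; rewrite mxE x0 mulr0.
Qed.

(** An eigenvector of [B] is determined by its first coordinate, so eigenspaces are lines; but the
    rows of [invmx P] are independent eigenvectors for the [s i]. *)
Lemma tridiagonal_diagonalizable_inj (K : fieldType) n (B P : 'M[K]_n.+1)
    (s : 'I_n.+1 -> K) :
  irreducible_tridiagonal B -> P \in unitmx ->
  P *m diag_mx (\row_i s i) = B *m P -> injective s.
Proof.
move=> B_trid PU PD i j sij; apply/eqP/negPn/negP => ij.
pose y l : 'rV[K]_n.+1 := row l (invmx P).
have yB l : y l *m B = s l *: y l.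
  rewrite /y -row_mul -[invmx P *m B]mulmx1 -(mulmxV PU) mulmxA -(mulmxA _ B) -PD.
  by rewrite mulmxA (mulVmx PU) mul1mx mul_diag_mx; apply/rowP => k; rewrite !mxE.
have y_neq0 l : y l 0 0 != 0.
  apply/negP => /eqP /(tridiagonal_eigenvector_eq0 B_trid (yB l)) yl.
  have := congr1 (row l) (mulVmx PU); rewrite row_mul -/(y l) yl mul0mx row1.
  by move/rowP/(_ l)/eqP; rewrite !mxE !eqxx eq_sym oner_eq0.
(* This combination cancels the first coordinates, and equal eigenvalues keep it in the
   eigenspace. *)
have : y j 0 0 *: y i - y i 0 0 *: y j = 0.
  apply: (tridiagonal_eigenvector_eq0 (a := s i) B_trid).
    by rewrite mulmxBl -!scalemxAl !yB sij scalerBr !scalerA ![s j * _]mulrC.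
  by rewrite !mxE mulrC subrr.
(* Multiplication by [P] turns [y i] and [y j] into distinct unit vectors, so the relation forces
   [y j 0 0 = 0]. *)
move/(congr1 (mulmx^~ P)); rewrite mul0mx mulmxBl -!scalemxAl /y -!row_mul (mulVmx PU).
move/rowP/(_ i)/eqP; rewrite !mxE eqxx (eq_sym j) (negPf ij) mulr1 mulr0 subr0.
by have := y_neq0 j; rewrite /y mxE => /negPf->.
Qed.

(** The two symmetries give [t i * G i j = t j * G i j]. For a Gram matrix of eigenvectors this is
    their orthogonality. *)
Lemma symmetric_commute_diag (K : fieldType) n (G : 'M[K]_n) (t : 'I_n -> K) :
  injective t -> G^T = G ->
  (diag_mx (\row_i t i) *m G)^T = diag_mx (\row_i t i) *m G ->
  exists g : 'I_n -> K, G = diag_mx (\row_i g i).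
Proof.
move=> t_inj GT tGT; exists (fun i => G i i); apply/matrixP => i j; rewrite !mxE.
have [->|ij] := eqVneq i j; first by rewrite mulr1n.
have /matrixP/(_ j i) := tGT; rewrite mxE !mul_diag_mx !mxE -[in G j i]GT mxE => /eqP.
rewrite -subr_eq0 -mulrBl mulf_eq0 subr_eq0 (inj_eq t_inj) (negPf ij).
by move/eqP.
Qed.

Section DualTridiagonal.
Variables (K : fieldType) (d : nat) (M : 'M[K]_d.+1) (s : 'I_d.+1 -> K).
Variables (t : nat -> K) (v : nat -> 'rV[K]_d.+1).
Hypothesis M_trid : irreducible_tridiagonal M.
Hypothesis t_inj : forall i j, (i <= d)%N -> (j <= d)%N -> t i = t j -> i = j.
Hypothesis v_chain : eigenchain M s t v d.
Let D := diag_mx (\row_i s i).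
Let P := prefix_mx v d.+1.

Lemma eigenchain_mulM : P *m M = diag_mx (\row_(i < d.+1) t i) *m P.
Proof.
apply/row_matrixP => i; rewrite row_mul rowK mul_diag_mx.
have [-> _] := v_chain.1 i (leq_ord i).
by apply/rowP => j; rewrite !mxE.
Qed.

Lemma eigenchain_unitmx : P \in unitmx.
Proof.
apply: (eigenvectors_unitmx _ eigenchain_mulM) => [i j tij|i].
  by apply/val_inj/t_inj => //; exact: leq_ord.
by rewrite rowK; have [] := v_chain.1 i (leq_ord i).
Qed.

(* With respect to a diagonal form making the tridiagonal matrix self-adjoint,
   its eigenvectors are orthogonal and the diagonal matrix is self-adjoint too,
   so a Hessenberg matrix of the latter is tridiagonal. *)
Lemma eigenchain_tridiagonal : irreducible_tridiagonal (P *m D *m invmx P).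
Proof.
have PU := eigenchain_unitmx; set B := P *m D *m invmx P.
have BP : B *m P = P *m D by rewrite /B mulmxKV.
clearbody B.
have [k k_neq0 kM] := tridiagonal_symmetrizer M_trid.
(* [G] is the Gram matrix of the eigenvectors for the form [Kd]. *)
pose Kd := diag_mx (\row_i k i); pose G := P *m Kd *m P^T.
have GT : G^T = G by rewrite /G !trmx_mul trmxK tr_diag_mx mulmxA.
have MKT : (M *m Kd)^T = M *m Kd.
  by apply/matrixP => i j; rewrite mxE !mul_mx_diag !mxE kM.
have tGT : (diag_mx (\row_(l < d.+1) t l) *m G)^T = diag_mx (\row_(l < d.+1) t l) *m G.
  have -> : diag_mx (\row_(l < d.+1) t l) *m G = P *m (M *m Kd) *m P^T.
    by rewrite /G !mulmxA -eigenchain_mulM.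
  by rewrite !trmx_mul trmxK -trmx_mul MKT mulmxA.
have t_ord_inj : injective (fun i : 'I_d.+1 => t i).
  by move=> i j tij; apply/val_inj/t_inj => //; exact: leq_ord.
have [g GD] := symmetric_commute_diag t_ord_inj GT tGT.
have g_neq0 i : g i != 0.
  have : G \in unitmx.
    rewrite /G !unitmx_mul unitmx_tr PU unitmxE det_diag unitfE andbT /=.
    by apply/prodf_neq0 => j _; rewrite mxE.
  by rewrite GD unitmxE det_diag unitfE => /prodf_neq0/(_ i isT); rewrite mxE.
(* Since [D] and [Kd] commute, [B *m G] is symmetric; as [G] is diagonal, this relates opposite
   entries of [B]. *)
have Bsym i j : B i j * g j = B j i * g i.
  have BGT : (B *m G)^T = B *m G.
    rewrite /G !mulmxA BP -(mulmxA P D) !trmx_mul trmxK !tr_diag_mx.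
    by rewrite [Kd *m D]diag_mxC mulmxA.
  by have /matrixP/(_ i j) := BGT; rewrite GD mxE !mul_mx_diag !mxE.
(* By the chain condition, row [i] of [B] is the unit vector at [i.+1] plus a combination of those
   at indices up to [i]. *)
have B_hess (i j : 'I_d.+1) : (i < j)%N -> B i j = (i.+1 == j)%:R.
  move=> ij; have id : (i < d)%N by rewrite (leq_trans ij) // leq_ord.
  have i1 : (i.+1 < d.+1)%N by [].
  have := @prefix_mx_coef _ _ v i.+1 (row i B - 'e_(Ordinal i1)) PU (ltnW i1).
  rewrite mulmxBl -row_mul -/P BP row_mul -rowE !rowK v_chain.2 // => /(_ isT j ij).
  by rewrite !mxE => /eqP; rewrite subr_eq0 => /eqP->; rewrite -val_eqE eq_sym.
apply/irreducible_tridiagonalP; split=> i j.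
  case/orP=> ij; first by rewrite B_hess ?ltn_eqF // ltnW.
  apply/eqP; have /eqP := Bsym i j.
  by rewrite [B j i]B_hess ?ltn_eqF ?mul0r ?mulf_eq0 ?(negPf (g_neq0 _)) ?orbF // ltnW.
move=> ij; have Bij : B i j = 1 by rewrite B_hess ?ij ?eqxx // -ij.
split; first by rewrite Bij oner_eq0.
apply/negP => /eqP Bji; have /eqP := Bsym i j.
by rewrite Bij Bji mul0r mul1r (negPf (g_neq0 _)).
Qed.

Lemma eigenchain_inj : injective s.
Proof.
apply: (tridiagonal_diagonalizable_inj eigenchain_tridiagonal eigenchain_unitmx).
by rewrite (mulmxKV eigenchain_unitmx).
Qed.

End DualTridiagonal.

(** * Linear maps in a basis *)

Section BasisMatrix.
Variables (K : fieldType) (V : vectType K) (n : nat) (e : n.-tuple V).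
Hypothesis e_basis : basis_of {:V} e.
Implicit Types (F G : 'End(V)) (x y : 'rV[K]_n).

(* [passmx.mxof] and [passmx.vecof] for a basis indexed by an [n] that is only
   provably equal to [\dim {:V}] *)
Definition lfmx F : 'M[K]_n := \matrix_(i, j) coord e j (F e`_i).
Definition lincomb x : V := \sum_i x 0 i *: e`_i.

Lemma lincomb_is_linear : linear lincomb.
Proof.
move=> a x y; rewrite scaler_sumr -big_split /=.
by apply: eq_bigr => i _; rewrite !mxE scalerDl scalerA.
Qed.
HB.instance Definition _ := GRing.isSemilinear.Build K _ _ _ lincomb
  (GRing.semilinear_linear lincomb_is_linear).

(** In an eigenbasis with distinct eigenvalues these projections are the primitive idempotents. *)
Definition basis_proj (i : 'I_n) (w : V) : V := coord e i w *: e`_i.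

Lemma basis_proj_is_linear i : linear (basis_proj i).
Proof. by move=> a x y; rewrite /basis_proj linearP scalerDl scalerA. Qed.
HB.instance Definition _ i := GRing.isSemilinear.Build K _ _ _ (basis_proj i)
  (GRing.semilinear_linear (basis_proj_is_linear i)).

Lemma basis_proj_nth (i j : 'I_n) :
  linfun (basis_proj i) e`_j = if i == j then e`_i else 0.
Proof.
rewrite lfunE /= /basis_proj coord_free ?(basis_free e_basis) // eq_sym.
by case: eqP; rewrite ?scale1r ?scale0r.
Qed.

Lemma coord_lincomb x i : coord e i (lincomb x) = x 0 i.
Proof. by rewrite coord_sum_free ?(basis_free e_basis). Qed.

Lemma lincomb_inj : injective lincomb.
Proof. by move=> x y xy; apply/rowP => i; rewrite -!coord_lincomb xy. Qed.

Lemma lincomb_coord (w : V) : lincomb (\row_i coord e i w) = w.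
Proof.
rewrite [RHS](coord_basis e_basis) ?memvf //.
by apply: eq_bigr => i _; rewrite mxE.
Qed.

Lemma lincomb_delta i : lincomb 'e_i = e`_i.
Proof.
rewrite /lincomb (bigD1 i) //= mxE !eqxx scale1r big1 ?addr0 // => j ji.
by rewrite mxE (negPf ji) andbF scale0r.
Qed.

Lemma lfmxE F (i : 'I_n) : F e`_i = lincomb (row i (lfmx F)).
Proof. by rewrite -[LHS]lincomb_coord; congr lincomb; apply/rowP => j; rewrite !mxE. Qed.

Lemma lfun_lincomb F x : F (lincomb x) = lincomb (x *m lfmx F).
Proof.
rewrite mulmx_sum_row !linear_sum /=; apply: eq_bigr => i _.
by rewrite !linearZ /= lfmxE.
Qed.

Lemma lfmxP F (B : 'M_n) : (forall i : 'I_n, F e`_i = lincomb (row i B)) -> lfmx F = B.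
Proof. by move=> FB; apply/row_matrixP => i; apply: lincomb_inj; rewrite -lfmxE. Qed.

Lemma basis_lfunP F G : (forall i : 'I_n, F e`_i = G e`_i) -> F = G.
Proof.
move=> FG; apply/lfunP => w; rewrite -(lincomb_coord w) !linear_sum /=.
by apply: eq_bigr => i _; rewrite !linearZ /= FG.
Qed.

Lemma basis_nth_neq0 (i : 'I_n) : e`_i != 0.
Proof. by rewrite (basis_not0 e_basis) // mem_nth ?size_tuple. Qed.

Lemma lincomb_rows_basis (P : 'M[K]_n) :
  P \in unitmx -> basis_of {:V} [tuple lincomb (row i P) | i < n].
Proof.
move=> PU; rewrite basisEfree subvf size_tuple (size_basis e_basis) leqnn !andbT.
apply/freeP => k; have -> : \sum_(i < n) k i *: [tuple lincomb (row i P) | i < n]`_i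
    = lincomb ((\row_i k i) *m P).
  rewrite mulmx_sum_row linear_sum; apply: eq_bigr => i _.
  by rewrite -tnth_nth tnth_mktuple linearZ /= mxE.
rewrite -(linear0 lincomb) => /lincomb_inj/(congr1 (mulmx^~ (invmx P))).
by rewrite mulmxK // mul0mx => /rowP k0 i; have := k0 i; rewrite !mxE.
Qed.

End BasisMatrix.

(** * Trace, diagonalizability and Leonard pairs read off a basis *)

Section Transfer.
Variables (K : fieldType) (V : vectType K).

Lemma mxof_lfmx (e : (\dim {:V}).-tuple V) (F : 'End(V)) : mxof e e F = lfmx e F.
Proof. by apply/matrixP => i j; rewrite !mxE /= vecof_delta. Qed.

(** Composing with the identity factors the matrix through a change of basis; cyclicity of the trace
    swaps the two factors. *)
Lemma lftrace_lfmx n (e : n.-tuple V) (F : 'End(V)) :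
  basis_of {:V} e -> lftrace F = \tr (lfmx e F).
Proof.
move=> e_basis; have hn := size_basis e_basis; subst n.
have b_basis := vbasisP {:V}; set b := vbasis {:V} in b_basis *.
rewrite -mxof_lfmx /lftrace -/b -[F in LHS]comp_lfun1r (mxof_comp _ _ e_basis).
by rewrite mxtrace_mulC -(mxof_comp _ _ b_basis) comp_lfun1l.
Qed.

Lemma leonard_pair_lfmx n (e e' : n.-tuple V) (A As : 'End(V)) :
  basis_of {:V} e -> irreducible_tridiagonal (lfmx e A) -> is_diag_mx (lfmx e As) ->
  basis_of {:V} e' -> irreducible_tridiagonal (lfmx e' As) -> is_diag_mx (lfmx e' A) ->
  leonard_pair A As.
Proof.
move=> e_basis; have hn := size_basis e_basis; subst n.
by split; [exists e | exists e']; rewrite !mxof_lfmx.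
Qed.

Lemma lfdiagonalizable_lfmx n (e : n.-tuple V) (A : 'End(V)) :
  basis_of {:V} e -> is_diag_mx (lfmx e A) -> lfdiagonalizable A.
Proof.
move=> e_basis; have hn := size_basis e_basis; subst n.
by exists e; rewrite ?mxof_lfmx.
Qed.

End Transfer.

(** * Leonard system data attached to an eigenbasis *)

Section Eigenbasis.
Variables (K : fieldType) (V : vectType K) (d : nat) (e : d.+1.-tuple V).
Variables (F : 'End(V)) (E : 'I_d.+1 -> 'End(V)) (t : 'I_d.+1 -> K).
Hypothesis e_basis : basis_of {:V} e.
Hypothesis E_e : forall i j : 'I_d.+1, E i e`_j = if i == j then e`_i else 0.

Lemma dual_idempotent_lfmx (G : 'End(V)) (i j : 'I_d.+1) :
  E i (G e`_j) = lfmx e G j i *: e`_i.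
Proof.
rewrite lfmxE // linear_sum (bigD1 i) //= linearZ /= E_e eqxx big1 ?addr0 ?mxE //.
by move=> l li; rewrite linearZ /= E_e eq_sym (negPf li) scaler0.
Qed.

(** [E i \o G \o E j] kills all basis vectors but the [j]-th, so it vanishes exactly when the entry
    [(j, i)] does. The transposition is harmless, the conditions being symmetric in the indices. *)
Lemma irreducible_tridiagonal_actionP (G : 'End(V)) :
  irreducible_tridiagonal_action E G <-> irreducible_tridiagonal (lfmx e G).
Proof.
have EGE (i j k : 'I_d.+1) : (E i \o G \o E j)%VF e`_k
    = if j == k then lfmx e G j i *: e`_i else 0.
  rewrite !comp_lfunE E_e; case: eqP => _; last by rewrite !linear0.
  exact: dual_idempotent_lfmx.
have EGE0 i j : (E i \o G \o E j)%VF = 0 <-> lfmx e G j i = 0.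
  split=> [EG0|B0].
    have := EGE i j j; rewrite EG0 eqxx zero_lfunE => /esym/eqP.
    by rewrite scaler_eq0 (negPf (basis_nth_neq0 e_basis i)) orbF => /eqP.
  apply: (basis_lfunP e_basis) => k; rewrite EGE B0 scale0r zero_lfunE.
  by case: eqP.
split=> [act|[G0 G1] i j].
  split=> i j; have [act0 act1] := act j i; rewrite distrC in act0 act1.
    by move=> /eqP Bij; rewrite leNgt; apply/negP => /act0/EGE0.
  by move=> /act1 EGEn; apply/eqP => /EGE0.
split=> ij; last by move/EGE0/eqP; apply/negP/G1; rewrite distrC.
by apply/EGE0/eqP/negPn/negP => /G0; rewrite distrC leNgt ij.
Qed.

Hypothesis t_inj : injective t.
Hypothesis F_e : forall i : 'I_d.+1, F e`_i = t i *: e`_i.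

Lemma lfmx_eigenbasis : lfmx e F = diag_mx (\row_i t i).
Proof.
apply: lfmxP => // i; rewrite F_e row_diag_mx linearZ /= lincomb_delta.
by rewrite mxE.
Qed.

Lemma leigenspaceP (G : 'End(V)) a x : reflect (G x = a *: x) (x \in leigenspace G a).
Proof.
rewrite memv_ker add_lfunE opp_lfunE scale_lfunE id_lfunE subr_eq0.
exact: eqP.
Qed.

(** The [i]-th coordinate of [F x = a *: x] shows that [t i] and [a] agree when multiplied by the
    coordinate of [x]. *)
Lemma eigenbasis_coord a x (i : 'I_d.+1) :
  F x = a *: x -> coord e i x != 0 -> t i = a.
Proof.
move/(congr1 (coord e i)); rewrite -{1}(lincomb_coord e_basis x).
rewrite lfun_lincomb // coord_lincomb // lfmx_eigenbasis mul_mx_diag !mxE linearZ /=.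
rewrite mulrC => /eqP; rewrite -subr_eq0 -mulrBl mulf_eq0 subr_eq0 => /orP[/eqP//|].
by move=> ->.
Qed.

Lemma leigenspace_eigenbasis (i : 'I_d.+1) : leigenspace F (t i) = <[e`_i]>%VS.
Proof.
apply/vspaceP => x; apply/leigenspaceP/vlineP => [Fx|[a ->]]; last first.
  by rewrite linearZ /= F_e !scalerA mulrC.
exists (coord e i x); rewrite -[x in LHS](lincomb_coord e_basis) /lincomb.
rewrite (bigD1 i) //= big1 ?addr0 ?mxE // => j ji; rewrite mxE.
have [->|/(eigenbasis_coord Fx)/t_inj ij] := eqVneq (coord e j x) 0.
  by rewrite scale0r.
by rewrite ij eqxx in ji.
Qed.

Lemma leigenvalue_eigenbasis a : leigenvalue F a <-> exists i, a = t i.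
Proof.
split=> [|[i ->]]; last first.
  by rewrite /leigenvalue leigenspace_eigenbasis -dimv_eq0 dim_vline basis_nth_neq0.
(* A nonzero eigenvector [x] has a nonzero coordinate, whose index gives the eigenvalue. *)
rewrite /leigenvalue -vpick0; set x := vpick _ => x_neq0.
have Fx : F x = a *: x by apply/leigenspaceP; exact: memv_pick.
case: (pickP (fun i => coord e i x != 0)) => [i xi|x0].
  by exists i; rewrite (eigenbasis_coord Fx xi).
case/eqP: x_neq0; rewrite -(lincomb_coord e_basis x) -[RHS](linear0 (lincomb e)).
by congr lincomb; apply/rowP => i; rewrite !mxE; apply/eqP/negPn; rewrite x0.
Qed.

Lemma multiplicity_free_eigenbasis : multiplicity_free F.
Proof.
split=> [|a /leigenvalue_eigenbasis[i ->]]; last first.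
  by rewrite leigenspace_eigenbasis dim_vline basis_nth_neq0.
apply: (lfdiagonalizable_lfmx e_basis).
by rewrite lfmx_eigenbasis diag_mx_is_diag.
Qed.

Lemma limg_eigenbasis i : limg (E i) = leigenspace F (t i).
Proof.
rewrite leigenspace_eigenbasis; apply/vspaceP => x; apply/memv_imgP/vlineP => [[y _ ->]|[a ->]].
  exists (coord e i y); rewrite -[y in LHS](lincomb_coord e_basis) linear_sum.
  rewrite (bigD1 i) //= linearZ /= E_e eqxx big1 ?addr0 ?mxE // => j ji.
  by rewrite linearZ /= E_e eq_sym (negPf ji) scaler0.
by exists (a *: e`_i); rewrite ?memvf // linearZ /= E_e eqxx.
Qed.

Lemma eigenvalue_sequence_eigenbasis : eigenvalue_sequence F E t.
Proof. by move=> i; rewrite limg_eigenbasis. Qed.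

Lemma primitive_idempotent_ordering_eigenbasis : primitive_idempotent_ordering F E.
Proof.
split=> [i j Eij|X].
  apply/eqP/negPn/negP => ij; have := E_e i i; rewrite Eij E_e eqxx eq_sym (negPf ij).
  by move/esym/eqP; rewrite (negPf (basis_nth_neq0 e_basis i)).
split=> [[a [/leigenvalue_eigenbasis[i ->] XX limgX kerX]]|[i ->]]; last first.
  exists (t i); split; first by apply/leigenvalue_eigenbasis; exists i.
  - apply: (basis_lfunP e_basis) => j; rewrite comp_lfunE !E_e.
    by case: eqP => [_|]; rewrite ?linear0 // E_e eqxx.
  - exact: limg_eigenbasis.
  move=> b bi; apply/subvP => x /leigenspaceP Fx; rewrite memv_ker; apply/eqP.
  rewrite -(lincomb_coord e_basis x) linear_sum big1 // => j _; rewrite linearZ /= E_e mxE.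
  case: eqP => [<-|]; last by rewrite scaler0.
  have [->|/(eigenbasis_coord Fx) tb] := eqVneq (coord e i x) 0; first by rewrite scale0r.
  by rewrite tb eqxx in bi.
(* An idempotent fixes its image, here the line of the [i]-th basis vector; the other basis vectors
   belong to other eigenspaces, which [X] kills. *)
exists i; apply: (basis_lfunP e_basis) => j; rewrite E_e.
have [<-|ij] := eqVneq i j.
  have : e`_i \in limg X by rewrite limgX leigenspace_eigenbasis memv_line.
  by case/memv_imgP => y _ ->; rewrite -comp_lfunE XX.
apply/eqP; rewrite -memv_ker; apply: subv_trans (kerX (t j) _) => //.
  by rewrite leigenspace_eigenbasis.
by rewrite (inj_eq t_inj) eq_sym.
Qed.

End Eigenbasis.

(** A nonzero vector is chosen in each image; applying [Es i] to a linear relation isolates its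
    [i]-th coefficient, and [d.+1] independent vectors form a basis. *)
Lemma orthogonal_idempotents_basis (K : fieldType) (V : vectType K) d
    (Es : 'I_d.+1 -> 'End(V)) :
  \dim {:V} = d.+1 -> orthogonal_idempotents Es ->
  exists2 u : d.+1.-tuple V, basis_of {:V} u &
    forall i j : 'I_d.+1, Es i u`_j = if i == j then u`_i else 0.
Proof.
move=> dimV [EE rkE].
pose u := [tuple vpick (limg (Es i)) | i < d.+1].
have uE (i : 'I_d.+1) : u`_i = vpick (limg (Es i)) by rewrite -tnth_nth tnth_mktuple.
have Eu (i j : 'I_d.+1) : Es i u`_j = if i == j then u`_i else 0.
  rewrite !uE; have /memv_imgP[y _ uy] := memv_pick (limg (Es j)).
  rewrite {1}uy -comp_lfunE EE; case: eqP => [->|_]; last by rewrite zero_lfunE.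
  by rewrite -uy.
have u_neq0 (i : 'I_d.+1) : u`_i != 0 by rewrite uE vpick0 -dimv_eq0 rkE.
exists u => //; rewrite basisEfree subvf size_tuple dimV leqnn !andbT.
apply/freeP => k ku i; move/(congr1 (Es i)): ku.
rewrite linear0 linear_sum (bigD1 i) //= linearZ /= Eu eqxx big1 ?addr0 => [|j ji].
  by move/eqP; rewrite scaler_eq0 (negPf (u_neq0 i)) orbF => /eqP.
by rewrite linearZ /= Eu eq_sym (negPf ji) scaler0.
Qed.

(** * Passage to coordinates and assembly of the Leonard system *)

Theorem theorem3p1 (K : fieldType) (d : nat) (d_ge1 : (1 <= d)%N)
    (V : vectType K) (dimV : \dim {:V} = d.+1)
    (Es : 'I_d.+1 -> 'End(V)) (Es_idem : orthogonal_idempotents Es)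
    (A : 'End(V)) (A_tridiag : irreducible_tridiagonal_action Es A)
    (ths : 'I_d.+1 -> K) (As : 'End(V))
    (As_def : As = \sum_(i < d.+1) ths i *: Es i)
    (th : 'I_d.+1 -> K)
    (h_i : forall i j : 'I_d.+1, i != j -> th i != th j)
    (h_ii : forall i : 'I_d.+1, (1 <= i)%N -> ths i != ths ord0)
    (beta gammas : K)
    (h_iii : three_term beta gammas ths)
    (h_iv : exists v0 v1 : V,
       [/\ v0 != 0 /\ v1 != 0,
           A v0 = th ord0 *: v0,
           A v1 = th (inord 1) *: v1
         & As v0 - v1 \in <[v0]>%VS])
    (gamma omega etas : K)
    (h_v : forall i : 'I_d.+1,
       lftrace (Es i \o A)%VF
         * (ths i - prev_term beta gammas ths i)
         * (ths i - next_term beta gammas ths i)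
       = gamma * ths i ^+ 2 + omega * ths i + etas)
    (h_vi : three_term beta gamma th) :
  leonard_pair_with_eigenvalues A As th ths.
Proof.
have [u u_basis Es_u] := orthogonal_idempotents_basis dimV Es_idem.
have As_u (i : 'I_d.+1) : As u`_i = ths i *: u`_i.
  rewrite As_def sum_lfunE (bigD1 i) //= scale_lfunE Es_u eqxx big1 ?addr0 // => j ji.
  by rewrite scale_lfunE Es_u (negPf ji) scaler0.
have As_mx : lfmx u As = diag_mx (\row_i ths i) by exact: lfmx_eigenbasis.
set M := lfmx u A; set D := diag_mx _ in As_mx.
have M_trid : irreducible_tridiagonal M.
  exact: (irreducible_tridiagonal_actionP u_basis Es_u A).1.
(* The scalars [a_i] are the diagonal entries of [M]. *)
have trE i : lftrace (Es i \o A)%VF = M i i.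
  have EsA_mx (j k : 'I_d.+1) : lfmx u (Es i \o A)%VF j k = M j i * (i == k)%:R.
    rewrite mxE comp_lfunE (dual_idempotent_lfmx u_basis Es_u) linearZ /=.
    by rewrite coord_free ?(basis_free u_basis).
  rewrite (lftrace_lfmx _ u_basis) /mxtrace (bigD1 i) //= EsA_mx eqxx mulr1.
  by rewrite big1 ?addr0 // => j ji; rewrite EsA_mx eq_sym (negPf ji) mulr0.
have aw : M *m D *m D - beta *: (D *m M *m D) + D *m D *m M
    - gammas *: (M *m D + D *m M)
    - (ths ord0 ^+ 2 - beta * ths ord0 * ths (inord 1) + ths (inord 1) ^+ 2
       - gammas * (ths ord0 + ths (inord 1))) *: M
  = gamma *: (D *m D) + omega *: D + etas%:M.
  by apply: askey_wilson => // i; rewrite -trE h_v.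
have ths_neq0 (i : 'I_d.+1) : i != 0 -> ths i != ths 0.
  by move=> i0; apply: h_ii; rewrite lt0n.
(* The chain takes eigenvalues indexed by [nat]; only indices up to [d] are meaningful. *)
pose t k := th (inord k).
have tE (i : 'I_d.+1) : t i = th i by rewrite /t inord_val.
have th_inj : injective th.
  by move=> i j /eqP tij; apply/eqP/negPn/negP => /h_i; rewrite tij.
have t_inj i j : (i <= d)%N -> (j <= d)%N -> t i = t j -> i = j.
  by move=> id jd /th_inj/(congr1 val); rewrite /= !inordK.
have t_rec k : (0 < k < d)%N -> t k.+1 = gamma + beta * t k - t k.-1.
  move=> kd; have k_lt : (k < d.+1)%N by case/andP: kd => _ /ltnW.
  by rewrite -(@h_vi (Ordinal k_lt) kd) /= -[th (Ordinal _)]tE /= -/(t _) -/(t _); ring.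
have [v0 [v1 [[v0_neq0 v1_neq0] Av0 Av1 /vlineP[c Asv0]]]] := h_iv.
have [v v_chain] : exists v, eigenchain M ths t v d.
  (* Coordinates in [u] turn the two given eigenvectors of [A] into row vectors that start the
     chain. *)
  pose x w := \row_i coord u i w.
  have xE F w : x w *m lfmx u F = x (F w).
    by apply: (lincomb_inj u_basis); rewrite -lfun_lincomb // !lincomb_coord.
  have x_lin a w : x (a *: w) = a *: x w by apply/rowP => i; rewrite !mxE linearZ.
  have x_neq0 w : w != 0 -> x w != 0.
    move=> w0; apply/negP => /eqP xw; case/eqP: w0.
    by rewrite -(lincomb_coord u_basis w) -/(x w) xw linear0.
  apply: (@eigenchain_exists _ _ _ _ t beta gammas _ gamma omega etas
    M_trid ths_neq0 aw t_inj t_rec (x v0) (x v1) c d_ge1).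
  - exact: x_neq0.
  - exact: x_neq0.
  - by rewrite xE Av0 x_lin -(tE ord0).
  - by rewrite xE Av1 x_lin.
  - rewrite -/D -As_mx xE -x_lin -Asv0.
    by apply/rowP => i; rewrite !mxE linearB.
set P := prefix_mx v d.+1.
have PU : P \in unitmx by exact: eigenchain_unitmx v_chain.
have B_trid := eigenchain_tridiagonal M_trid t_inj v_chain.
have ths_inj : injective ths by exact: eigenchain_inj M_trid t_inj v_chain.
(* The chain carried back to [V]: an eigenbasis of [A] in which [As] has the irreducible tridiagonal
   matrix [P *m D *m invmx P]. *)
pose e := [tuple lincomb u (row i P) | i < d.+1].
have eE (i : 'I_d.+1) : e`_i = lincomb u (row i P) by rewrite -tnth_nth tnth_mktuple.
have e_basis : basis_of {:V} e by exact: lincomb_rows_basis.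
have A_e (i : 'I_d.+1) : A e`_i = th i *: e`_i.
  rewrite eE lfun_lincomb // -row_mul (eigenchain_mulM v_chain) -linearZ /=.
  by congr lincomb; apply/rowP => j; rewrite mul_diag_mx !mxE tE.
have As_mx_e : lfmx e As = P *m D *m invmx P.
  apply: (lfmxP e_basis) => i; rewrite eE lfun_lincomb // As_mx -row_mul.
  rewrite -[in LHS](mulmxKV PU (P *m D)) row_mul mulmx_sum_row linear_sum.
  by apply: eq_bigr => j _; rewrite linearZ /= eE.
pose E i : 'End(V) := linfun (basis_proj e i).
have E_e := basis_proj_nth e_basis.
split.
  (* The basis [u] serves for the first half of the definition, [e] for the second. *)
  apply: (leonard_pair_lfmx u_basis M_trid _ e_basis).
  - by rewrite As_mx diag_mx_is_diag.
  - by rewrite As_mx_e.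
  - by rewrite (lfmx_eigenbasis e_basis A_e) diag_mx_is_diag.
exists E, Es; split; last 2 first.
- exact: eigenvalue_sequence_eigenbasis e_basis E_e th_inj A_e.
- exact: eigenvalue_sequence_eigenbasis u_basis Es_u ths_inj As_u.
split=> //.
- by split; [exact: multiplicity_free_eigenbasis e_basis th_inj A_e
            |exact: multiplicity_free_eigenbasis u_basis ths_inj As_u].
- exact: primitive_idempotent_ordering_eigenbasis e_basis E_e th_inj A_e.
- exact: primitive_idempotent_ordering_eigenbasis u_basis Es_u ths_inj As_u.
- by apply/(irreducible_tridiagonal_actionP e_basis E_e); rewrite As_mx_e.
Qed.
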